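(* Let $(N,v)$ be the MCST-saving game defined by a non-negatively weighted complete graph $\langle K[N_r], w\rangle$, where $N=\{1,\dots,n\}$ and $N_r=N\cup\{r\}$. For any player $i\in N$, the following statements are equivalent: (0) the Shapley value of player $i$ in $(N,v)$ is zero, i.e. $\phi_i=0$; (1) player $i$ is a null player, i.e. $v(S\cup\{i\})=v(S)$ for all $S\subseteq N\setminus\{i\}$; (2) $v(\{i,j\})=v(\{j\})$ for all $j\in N\setminus\{i\}$; (3) for all $j\in N\setminus\{i\}$, $w(r,i)\leq w(i,j)$ and $w(r,j)\le w(i,j)$.
   Context: Let $N=\{1,\dots,n\}$ be a set of players, $r\notin N$ a distinguished node (the root), and $N_r=N\cup\{r\}$. $K[V]$ denotes the undirected complete graph on vertex set $V$. A non-negatively weighted complete graph $\langle K[N_r],w\rangle$ consists of $K[N_r]$ together with a weight $w(i,j)=w(j,i)\ge 0$ for each edge $\{i,j\}$. For non-empty $S\subseteq N$, $c(S)$ is the minimum of $\sum_{e\in T}w(e)$ over all spanning trees $T$ (identified with their edge sets) of $K[S\cup\{r\}]$, and $c(\emptyset)=0$. The pair $(N,c)$ is the MCST (minimum cost spanning tree) game. The associated MCST-saving game $(N,v)$ is defined by $v(S)=\sum_{i\in S}c(\{i\})-c(S)=\sum_{i\in S}w(r,i)-c(S)$, $v(\emptyset)=0$. A permutation of $N$ is a bijection $\pi:\{1,\dots,n\}\to N$; $\Pi_N$ is the set of all of them. $\mathrm{Prc}(\pi,i)$ is the set of players preceding $i$ in $\pi$. The Shapley value of $(N,v)$ is $\phi_i=\frac{1}{n!}\sum_{\pi\in\Pi_N}\bigl(v(\mathrm{Prc}(\pi,i)\cup\{i\})-v(\mathrm{Prc}(\pi,i))\bigr)$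 for $i\in N$. *)

(* Defs.v *)
From mathcomp Require Import all_boot all_order all_algebra all_fingroup.

Set Implicit Arguments.
Unset Strict Implicit.
Unset Printing Implicit Defensive.

Import Order.TTheory GRing.Theory Num.Theory.
Local Open Scope ring_scope.

Section SpanningTrees.
Variable U : finType.
Implicit Types (V : {set U}) (T : {set {set U}}).

(* Edges of the complete graph K[V]: the two-element subsets of V. *)
Definition edges V : {set {set U}} := [set e : {set U} | (e \subset V) && (#|e| == 2)].

Definition adj T : rel U := fun x y => [set x; y] \in T.

Definition connected V T : bool :=
  [forall x in V, forall y in V, connect (adj T) x y].

(* No simple cycle with at least three vertices. Bounding the length makes this
   a boolean; acyclicP shows that the bound is harmless. *)
Definition acyclic T : bool :=
  [forall k : 'I_#|U|.+1, forall c : k.-tuple U, (2 < k)%N ==> ~~ ucycleb (adj T) c].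

Definition spanning_tree V T : bool :=
  [&& T \subset edges V, connected V T & acyclic T].

Lemma acyclicP T :
  reflect (forall c : seq U, (2 < size c)%N -> ~ ucycle (adj T) c) (acyclic T).
Proof.
apply: (iffP forallP) => [acy c c3 cyc|acy k].
  have lt_c : (size c < #|U|.+1)%N.
    by rewrite ltnS; case/andP: cyc => _ /card_uniqP <-; apply: max_card.
  have /forallP/(_ (in_tuple c))/implyP/(_ c3)/negP := acy (Ordinal lt_c).
  by apply.
by apply/forallP=> c; apply/implyP=> k3; apply/negP=> /acy; apply; rewrite size_tuple.
Qed.

End SpanningTrees.

Section MCSTGame.
Variables (R : realFieldType) (n : nat).

(* Players are the elements of 'I_n (0-based); None is the root r. *)
Definition node := option 'I_n.
Definition root_node : node := None.

(* A weighting w is a function on edges seen as sets of nodes, so that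
   w(i,j) = w(j,i) holds by construction; only its values on two-element sets
   are ever used. *)
Implicit Types (w : {set node} -> R) (S : {set 'I_n}) (v : {set 'I_n} -> R).

Definition wt w (x y : node) : R := w [set x; y].

(* The node set S :|: {r}. *)
Definition rooted S : {set node} := root_node |: [set Some i | i in S].

Definition star S : {set {set node}} := [set [set root_node; Some i] | i in S].

Definition tree_weight w (T : {set {set node}}) : R := \sum_(e in T) w e.

(* The star only witnesses that a spanning tree exists (star_spanning_tree);
   mst_cost_min shows that mst_cost is the minimum over all spanning trees. *)
Definition min_spanning_tree w S : {set {set node}} :=
  [arg min_(T < star S | spanning_tree (rooted S) T) tree_weight w T]%O.

Definition mst_cost w S : R := tree_weight w (min_spanning_tree w S).

Definition saving_game w S : R := \sum_(i in S) mst_cost w [set i] - mst_cost w S.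

(* A permutation p sends a position k to the player p k. *)
Definition Prc (p : {perm 'I_n}) (i : 'I_n) : {set 'I_n} :=
  [set j | ((p^-1)%g j < (p^-1)%g i)%N].

Definition shapley v (i : 'I_n) : R :=
  (n`!)%:R^-1 * \sum_(p : {perm 'I_n}) (v (i |: Prc p i) - v (Prc p i)).

Definition null_player v (i : 'I_n) : Prop :=
  forall S, i \notin S -> v (i |: S) = v S.

Lemma star_root S x y : adj (star S) x y -> x != y /\ (x == root_node) || (y == root_node).
Proof.
case/imsetP=> i _ eq_xy.
have: root_node \in [set x; y] by rewrite eq_xy !inE eqxx.
have: Some i \in [set x; y] by rewrite eq_xy !inE eqxx orbT.
rewrite !inE => xyi xyr; split; last by rewrite !(eq_sym _ root_node).
by apply: contraL xyi => /eqP exy; move: xyr; rewrite exy !orbb => /eqP <-.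
Qed.

Lemma star_spanning_tree S : spanning_tree (rooted S) (star S).
Proof.
apply/and3P; split.
- apply/subsetP=> _ /imsetP[i Si ->]; rewrite inE cards2 andbT.
  by apply/subsetP=> x; rewrite !inE => /orP[->//|/eqP->]; rewrite imset_f ?orbT.
- have rx x : x \in rooted S ->
      connect (adj (star S)) root_node x /\ connect (adj (star S)) x root_node.
    rewrite !inE => /orP[/eqP->|/imsetP[i Si ->]]; first by rewrite connect0.
    by split; apply: connect1; rewrite /adj 1?(setUC [set Some i]); apply/imsetP; exists i.
  apply/forall_inP=> x /rx[_ xr]; apply/forall_inP=> y /rx[ry _].
  exact: connect_trans xr ry.
- apply/acyclicP=> -[|x [|y [|z c]]] // _.
  rewrite /ucycle /= !inE !negb_or => /andP[/and3P[xy yz zc]].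
  case/andP=> /and3P[nxy nxz nxc] /andP[/andP[nyz nyc] _].
  have [_ /orP xyr] := star_root xy; have [_ /orP yzr] := star_root yz.
  have yr : y == root_node.
    case: xyr => // xr; case: yzr => // zr.
    by rewrite (eqP xr) (eqP zr) eqxx in nxz.
  have zr : z != root_node by rewrite -(eqP yr) eq_sym.
  case: c zc nxc nyc => [|t c] /=; rewrite ?andbT.
    move=> /star_root[_]; rewrite (negPf zr) => /= xr.
    by rewrite (eqP xr) (eqP yr) eqxx in nxy.
  case/andP=> /star_root[_]; rewrite (negPf zr) => /= tr _ _.
  by rewrite inE (eqP yr) (eqP tr) eqxx.
Qed.

Lemma mst_cost_min w S :
  (exists2 T, spanning_tree (rooted S) T & mst_cost w S = tree_weight w T) /\
  (forall T, spanning_tree (rooted S) T -> mst_cost w S <= tree_weight w T).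
Proof.
rewrite /mst_cost /min_spanning_tree.
case: arg_minP => [|T stT minT]; first exact: star_spanning_tree.
by split; first exists T.
Qed.

Lemma mst_cost0 w : mst_cost w set0 = 0.
Proof.
have [[T /and3P[/subsetP sTV _ _] ->] _] := mst_cost_min w set0.
rewrite /tree_weight big1 // => e /sTV; rewrite inE => /andP[/subset_leq_card].
by rewrite /rooted imset0 setU0 cards1 => le_e1 /eqP e2; rewrite e2 in le_e1.
Qed.

Lemma mst_cost1 w i : mst_cost w [set i] = wt w root_node (Some i).
Proof.
have [[T /and3P[/subsetP sTV /forall_inP conT _] ->] _] := mst_cost_min w [set i].
have rootedE : rooted [set i] = [set root_node; Some i] by rewrite /rooted imset_set1.
have T1 e : e \in T -> e = [set root_node; Some i].
  move/sTV; rewrite inE rootedE => /andP[sub /eqP e2].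
  by apply/eqP; rewrite eqEcard sub e2 cards2.
suff -> : T = [set [set root_node; Some i]] by rewrite /tree_weight big_set1.
apply/setP=> e; rewrite inE; apply/idP/eqP=> [/T1 //|->].
have /conT/forall_inP/(_ (Some i)) : root_node \in rooted [set i].
  by rewrite rootedE !inE eqxx.
rewrite rootedE !inE eqxx orbT => /(_ isT)/connectP[[|x p] //=].
by case/andP=> Tx _ _; rewrite -(T1 _ Tx).
Qed.

End MCSTGame.

(* Main.v *)
(** For nonnegative weights, [mst_cost w S] is a lower bound for the weight of
    every connected edge set on the nodes of [S] and the root, since a minimal
    connected subset is a tree. Attaching [i] to the root therefore shows that
    the marginal contributions of [i] are nonnegative, so a zero Shapley value
    forces all of them to vanish. Conversely, in an optimal tree for
    [S] and [i], condition (3) allows one to exchange the first edge on the path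
    from [i] to the root for the edge from the root to [i], and then to contract [i]
    into the root, without increasing weights; this leaves a connected edge set
    for [S] of weight at most [mst_cost w (i |: S) - w(r, i)]. *)

Require Import Defs.
From mathcomp Require Import all_boot all_order all_algebra all_fingroup.

Set Implicit Arguments.
Unset Strict Implicit.
Unset Printing Implicit Defensive.

Import Order.TTheory GRing.Theory Num.Theory.
Local Open Scope ring_scope.

(** * Connected edge sets and the spanning trees inside them *)

Section ConnectedEdgeSets.
Variable U : finType.
Implicit Types (V : {set U}) (T : {set {set U}}) (x y z : U).

Lemma adj_sym T : symmetric (adj T).
Proof. by move=> x y; rewrite /adj setUC. Qed.

Lemma connect_adj_sym T : connect_sym (adj T).
Proof. exact: sym_connect_sym (@adj_sym T). Qed.

Lemma connectedP V T :
  reflect {in V &, forall x y, connect (adj T) x y} (connected V T).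
Proof.
apply: (iffP forall_inP) => [conT x y Vx|conT x Vx].
  by move: y; apply/forall_inP/conT.
by apply/forall_inP=> y; apply: conT.
Qed.

Lemma connected_sub V T T' :
  subrel (adj T) (connect (adj T')) -> connected V T -> connected V T'.
Proof.
move=> sTT' /connectedP conT; apply/connectedP=> x y Vx Vy.
exact: connect_sub sTT' _ _ (conT x y Vx Vy).
Qed.

Lemma edgesP V e :
  reflect (exists x y, [/\ e = [set x; y], x != y, x \in V & y \in V])
          (e \in edges V).
Proof.
rewrite inE; apply: (iffP andP) => [[sV /cards2P[x [y [nxy eE]]]]|].
  by exists x, y; split=> //; apply: (subsetP sV); rewrite eE !inE eqxx ?orbT.
case=> x [y [-> nxy Vx Vy]]; rewrite cards2 nxy; split=> //.
by apply/subsetP=> z; rewrite !inE => /orP[]/eqP->.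
Qed.

(** A path that never visits [y] traverses no edge containing [y], so deleting such an edge leaves
    the path intact. *)
Lemma path_avoid T (e : {set U}) y z p :
  y \in e -> y \notin z :: p -> path (adj T) z p -> path (adj (T :\ e)) z p.
Proof.
move=> ye; elim: p z => //= t p IHp z; rewrite inE negb_or => /andP[nyz nytp].
case/andP=> zt tp; rewrite IHp // andbT /adj !inE [_ \in T]zt andbT.
apply: contraL ye => /eqP<-; move: nytp; rewrite !inE !negb_or.
by case/andP=> -> _; rewrite nyz.
Qed.

(** Every use of the deleted edge can be rerouted along the remaining connection between its
    ends. *)
Lemma connected_setD1 V T x y :
  connect (adj (T :\ [set x; y])) x y -> connected V T ->
  connected V (T :\ [set x; y]).
Proof.
move=> xy; apply: connected_sub => a b ab.
have [abE|nab] := eqVneq [set a; b] [set x; y]; last first.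
  by apply: connect1; rewrite /adj in_setD1 nab.
have: a \in [set x; y] by rewrite -abE !inE eqxx.
have: b \in [set x; y] by rewrite -abE !inE eqxx orbT.
by rewrite !inE => /orP[]/eqP-> /orP[]/eqP->; rewrite ?connect0 // connect_adj_sym.
Qed.

(** Take an inclusion-minimal connected subset of [T]. If it had a cycle, the rest of the cycle
    would join the ends of any edge on it, so that edge could be dropped, against minimality. *)
Lemma connected_spanning_tree V T :
    T \subset edges V -> connected V T ->
  exists2 T' : {set {set U}}, T' \subset T & spanning_tree V T'.
Proof.
move=> sTV conT; have [T' minT' sT'] := @minset_exists _ (connected V) T conT.
have [conT' minT] := minsetP minT'.
exists T' => //; apply/and3P; split=> //; first exact: subset_trans sTV.
apply/acyclicP=> -[|x [|y [|z q]]] // _ /andP[] /= /and3P[xy yz zq].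
rewrite !inE !negb_or -!andbA => /and5P[nxy nxz _ nyz /andP[nyq _]].
suff cxy : connect (adj (T' :\ [set x; y])) x y.
  have /setP/(_ [set x; y]) := minT _ (connected_setD1 cxy conT') (subsetDl _ _).
  by rewrite in_setD1 eqxx [_ \in T']xy.
(* Go round the cycle the other way: from [y] to the third vertex [z], then from [z] back to [x]
   without meeting [y] again. *)
rewrite connect_adj_sym; apply: (@connect_trans _ _ z).
  apply: connect1; rewrite /adj in_setD1 [_ \in T']yz andbT.
  apply/eqP=> /setP/(_ x); rewrite !inE eqxx (negPf nxy) (negPf nxz).
  by [].
apply/connectP; exists (rcons q x); last by rewrite last_rcons.
apply: (@path_avoid _ _ y) zq; first by rewrite !inE eqxx orbT.
by rewrite inE mem_rcons inE !negb_or nyz nyq eq_sym nxy.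
Qed.

End ConnectedEdgeSets.

(** * Sums over images, and coalitions as sets of predecessors *)

(** Elements of [A] with the same image are counted once on the left and separately on the right,
    where the surplus terms are nonnegative. This handles edges that become equal under
    contraction. *)
Lemma ler_sum_imset (R : numDomainType) (I J : finType) (h : I -> J)
    (A : {set I}) (F : J -> R) :
    {in h @: A, forall j, 0 <= F j} ->
  \sum_(j in h @: A) F j <= \sum_(i in A) F (h i).
Proof.
move=> F_ge0; rewrite (partition_big_imset h) /=; apply: ler_sum => j hAj.
have /imsetP[i Ai jE] := hAj.
rewrite (bigD1 i) /=; last by rewrite Ai jE eqxx.
rewrite -jE lerDl; apply: sumr_ge0 => k /andP[/andP[Ak /eqP->] _].
exact: F_ge0.
Qed.

(** List the members of [S] first, then [i], then all other players; the permutation reads off this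
    list. *)
Lemma exists_Prc n (i : 'I_n) (S : {set 'I_n}) :
  i \notin S -> exists p : {perm 'I_n}, Prc p i = S.
Proof.
move=> nSi; pose s := enum S ++ i :: enum (~: (i |: S)).
have s_all j : j \in s.
  by rewrite mem_cat inE !mem_enum !inE; case: (j \in S); case: (j == i).
have s_uniq : uniq s.
  rewrite cat_uniq cons_uniq !enum_uniq mem_enum !inE eqxx andbT /=.
  rewrite mem_enum (negPf nSi) andbT; apply/hasPn=> j.
  by rewrite !mem_enum !inE negb_or => /andP[].
have s_size : size s = n.
  rewrite -(card_uniqP s_uniq) -[RHS]card_ord; apply: eq_card => j.
  by rewrite s_all.
pose f (k : 'I_n) := nth i s k.
have f_inj : injective f.
  move=> a b /eqP; rewrite nth_uniq ?s_size // => /eqP; exact: val_inj.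
exists (perm f_inj).
have invE j : (perm f_inj)^-1%g j = index j s :> nat.
  rewrite -{2}[j](permKV (perm f_inj)) permE index_uniq // s_size.
  exact: ltn_ord.
(* Player [i] sits right after the block [enum S], so the smaller positions are exactly those of
   members of [S]. *)
apply/setP=> j; rewrite inE !invE !index_cat !mem_enum (negPf nSi) /= eqxx addn0.
case: ifP => Sj; first by rewrite index_mem mem_enum.
by rewrite ltnNge leq_addr.
Qed.

(** * Marginal savings, and necessity of the weight condition *)

Section Savings.
Variables (R : realFieldType) (n : nat) (w : {set node n} -> R).
Hypothesis w_ge0 : forall x y : node n, x != y -> 0 <= wt w x y.
Implicit Types (S : {set 'I_n}) (i j : 'I_n) (T : {set {set node n}}).

Local Notation r := (root_node n).

Lemma root_rooted S : r \in rooted S.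
Proof. by rewrite !inE eqxx. Qed.

Lemma Some_rooted S i : (Some i \in rooted S) = (i \in S).
Proof. by rewrite !inE /= mem_imset // => ? ? []. Qed.

Lemma rootedU1 S i : rooted (i |: S) = Some i |: rooted S.
Proof. by rewrite /rooted imsetU1 setUCA. Qed.

Lemma in_rootedU1 S i x :
  (x \in rooted (i |: S)) = (x == Some i) || (x \in rooted S).
Proof. by rewrite rootedU1 in_setU1. Qed.

Lemma edge_ge0 (V : {set node n}) e : e \in edges V -> 0 <= w e.
Proof. by case/edgesP=> x [y [-> nxy _ _]]; apply: w_ge0. Qed.

Lemma tree_weight_sub (V : {set node n}) T T' :
  T \subset edges V -> T' \subset T -> tree_weight w T' <= tree_weight w T.
Proof.
move=> sTV sT'T; rewrite /tree_weight [leRHS](big_setID T') /= (setIidPr sT'T) lerDl.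
apply: sumr_ge0 => e /setDP[/(subsetP sTV) Ve _]; exact: edge_ge0 Ve.
Qed.

Lemma tree_weight_setU1 T e :
  0 <= w e -> tree_weight w (e |: T) <= w e + tree_weight w T.
Proof.
move=> we; rewrite /tree_weight; have [Te|nTe] := boolP (e \in T).
  by rewrite (setUidPr _) ?sub1set // lerDr.
by rewrite big_setU1.
Qed.

Lemma mst_cost_le S T :
    T \subset edges (rooted S) -> connected (rooted S) T ->
  mst_cost w S <= tree_weight w T.
Proof.
move=> sTS conT; have [T' sT'T stT'] := connected_spanning_tree sTS conT.
exact: le_trans ((mst_cost_min w S).2 _ stT') (tree_weight_sub sTS sT'T).
Qed.

(** Hang [i] as a leaf on the node [x] of an optimal tree for [S]. Taking [x] to be the root bounds
    marginals; taking it to be a player yields the weight inequalities. *)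
Lemma mst_cost_setU1 S i x :
  i \notin S -> x \in rooted S ->
  mst_cost w (i |: S) <= wt w x (Some i) + mst_cost w S.
Proof.
move=> nSi Sx; have [[T /and3P[sTS /connectedP conT _] ->] _] := mst_cost_min w S.
have nxi : x != Some i by apply: contraNneq nSi => xE; rewrite -Some_rooted -xE.
have sub : subrel (adj T) (adj ([set x; Some i] |: T)).
  by move=> a b; rewrite /adj !inE => ->; rewrite orbT.
apply: le_trans (tree_weight_setU1 _ (w_ge0 nxi)); apply: mst_cost_le.
  rewrite subUset sub1set; apply/andP; split.
    by apply/edgesP; exists x, (Some i); rewrite !in_rootedU1 Sx eqxx orbT.
  apply: (subset_trans sTS); apply/subsetP=> e; rewrite !inE rootedU1.
  by case/andP=> /subset_trans-> //; apply: subsetU1.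
have conx y : y \in rooted (i |: S) ->
    connect (adj ([set x; Some i] |: T)) x y.
  rewrite in_rootedU1 => /predU1P[->|Sy].
    by apply: connect1; rewrite /adj setU11.
  by apply: connect_sub (conT x y Sx Sy) => a b /sub/connect1.
apply/connectedP=> y z /conx xy /conx; apply: connect_trans.
by rewrite connect_adj_sym.
Qed.

Lemma saving_marginal S i : i \notin S ->
  saving_game w (i |: S) - saving_game w S =
  wt w r (Some i) + mst_cost w S - mst_cost w (i |: S).
Proof.
move=> nSi; rewrite /saving_game big_setU1 //= mst_cost1.
by rewrite opprB addrA addrAC (addrAC _ (- mst_cost _ _)) addrK addrAC.
Qed.

Lemma saving_marginal_ge0 S i : i \notin S ->
  0 <= saving_game w (i |: S) - saving_game w S.
Proof.
move=> nSi; rewrite saving_marginal // subr_ge0.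
exact: mst_cost_setU1 (root_rooted S).
Qed.

Lemma notin_Prc (p : {perm 'I_n}) i : i \notin Prc p i.
Proof. by rewrite inE ltnn. Qed.

Lemma shapley_eq0_null i :
  shapley (saving_game w) i = 0 -> null_player (saving_game w) i.
Proof.
move/eqP; rewrite mulf_eq0 invr_eq0 pnatr_eq0 -leqn0 leqNgt fact_gt0 /=.
rewrite psumr_eq0 => [/allP marg0 S nSi|p _]; last first.
  exact: saving_marginal_ge0 (notin_Prc p i).
have [p pS] := exists_Prc nSi.
by have /marg0/implyP/(_ isT) := mem_index_enum p; rewrite pS subr_eq0 => /eqP.
Qed.

Lemma pair_marginal i j : j != i ->
  saving_game w [set i; j] - saving_game w [set j] =
  wt w r (Some i) + wt w r (Some j) - mst_cost w [set i; j].
Proof.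
move=> nji; rewrite saving_marginal ?mst_cost1 //.
by rewrite inE eq_sym.
Qed.

(** A zero marginal makes the star optimal on the two players. Comparing it with the two paths in
    which one player hangs on the other gives the two inequalities. *)
Lemma pair_null_root_le i j :
    j != i -> saving_game w [set i; j] = saving_game w [set j] ->
  wt w r (Some i) <= wt w (Some i) (Some j) /\
  wt w r (Some j) <= wt w (Some i) (Some j).
Proof.
move=> nji /eqP; rewrite -subr_eq0 pair_marginal // subr_eq0 => /eqP cE.
split.
  rewrite -(lerD2r (wt w r (Some j))) cE -mst_cost1 /wt (setUC [set Some i]).
  by apply: mst_cost_setU1; rewrite ?Some_rooted inE // eq_sym.
rewrite -(lerD2r (wt w r (Some i))) addrC cE -mst_cost1 setUC.
by apply: mst_cost_setU1; rewrite ?Some_rooted inE.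
Qed.

(** * Sufficiency of the weight condition *)

Section RootNearest.
Variable i : 'I_n.
Hypothesis near_root : forall j, j != i ->
  wt w r (Some i) <= wt w (Some i) (Some j) /\
  wt w r (Some j) <= wt w (Some i) (Some j).

Lemma exchange_root_edge S T : i \in S ->
    T \subset edges (rooted S) -> connected (rooted S) T ->
  exists T', [/\ T' \subset edges (rooted S), connected (rooted S) T',
    [set r; Some i] \in T' & tree_weight w T' <= tree_weight w T].
Proof.
move=> Si sTS conT; have [Tri|nTri] := boolP ([set r; Some i] \in T).
  by exists T.
have /connectP[p0 p0T r_last] : connect (adj T) (Some i) r.
  by apply: (connectedP _ _ conT); rewrite ?root_rooted ?Some_rooted.
(* On a simple path from [i] to the root, the part after the first edge [e] avoids [i], hence
   survives the deletion of [e]. *)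
move: r_last; case/shortenP: p0T => [[//|x p]] /= /andP[ix xp].
case/andP=> nip _ _ r_last; pose e := [set Some i; x].
have Te : e \in T := ix.
have nix : Some i != x by apply: contraNneq nip => ->; rewrite inE eqxx.
(* The neighbour [x] is not the root, since the edge from [i] to the root is absent; so [near_root]
   applies to it. *)
have [j xE] : exists j, x = Some j.
  by case: {+}x ix => [j _|]; [exists j | rewrite /adj setUC (negPf nTri)].
have nji : j != i by apply: contraNneq nix => jE; rewrite xE jE.
have nre : [set r; Some i] != e by apply: contraNneq nTri => ->.
pose T1 := [set r; Some i] |: T; have subT1 : subrel (adj T) (adj T1).
  by move=> a b; rewrite /adj in_setU1 => ->; rewrite orbT.
have xr : connect (adj (T1 :\ e)) x r.
  apply/connectP; exists p => //; apply: (@path_avoid _ _ _ (Some i)) => //.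
    by rewrite !inE eqxx.
  exact: sub_path subT1 _ _ xp.
exists (T1 :\ e); split.
- apply: subset_trans (subsetDl _ _) _; rewrite subUset sub1set sTS andbT.
  by apply/edgesP; exists r, (Some i); rewrite root_rooted Some_rooted.
- apply: connected_setD1; last first.
    by apply: connected_sub conT => a b /subT1/connect1.
  rewrite connect_adj_sym; apply: connect_trans xr (connect1 _).
  by rewrite /adj in_setD1 nre setU11.
- by rewrite in_setD1 nre setU11.
(* Adding [w e] to both sides restores the sum over [T1] on the left; what remains is to compare the
   new edge with [e]. *)
- rewrite -(lerD2l (w e)) /tree_weight -big_setD1 ?in_setU1 ?Te ?orbT //=.
  by rewrite big_setU1 //= lerD2r /e xE; exact: (near_root nji).1.
Qed.

Let contract (x : node n) : node n := if x == Some i then r else x.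

Lemma mst_cost_contract S : i \notin S ->
  wt w r (Some i) + mst_cost w S <= mst_cost w (i |: S).
Proof.
move=> nSi; have [[T0 /and3P[sT0 conT0 _] ->] _] := mst_cost_min w (i |: S).
have [T [sT conT Tri leT]] := exchange_root_edge (setU11 i S) sT0 conT0.
apply: le_trans leT; rewrite /tree_weight (big_setD1 _ Tri) /= lerD2l.
pose h (e : {set node n}) := contract @: e.
have hE x y : h [set x; y] = [set contract x; contract y].
  by rewrite /h imsetU1 imset_set1.
have cS z : z \in rooted S -> contract z = z.
  move=> Sz; rewrite /contract; case: eqP => // zE.
  by rewrite zE Some_rooted (negPf nSi) in Sz.
have edgeT e : e \in T :\ [set r; Some i] ->
    h e \in edges (rooted S) /\ w (h e) <= w e.
  (* An edge from [i] to [y] becomes one from the root to [y]. As the root edge of [i] is excluded,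
     [y] is a player and the second inequality of [near_root] applies. *)
  have hi y : y \in rooted S -> [set Some i; y] != [set r; Some i] ->
      h [set Some i; y] \in edges (rooted S) /\
      w (h [set Some i; y]) <= w [set Some i; y].
    move=> Sy ne; rewrite hE (cS y Sy) /contract eqxx.
    have [j yE] : exists j, y = Some j.
      by case: y {Sy} ne => [j _|]; [exists j | rewrite setUC eqxx].
    have nji : j != i by apply: contraNneq nSi => <-; rewrite -Some_rooted -yE.
    split; last by rewrite yE; exact: (near_root nji).2.
    by apply/edgesP; exists r, y; rewrite Sy root_rooted yE.
  case/setD1P=> + /(subsetP sT)/edgesP[x [y [eE nxy]]].
  rewrite {e}eE !in_rootedU1 => ne /predU1P[xi|Sx] /predU1P[yi|Sy].
  - by rewrite xi yi eqxx in nxy.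
  - by move: ne; rewrite xi; apply: hi.
  - by move: ne; rewrite yi setUC; apply: hi.
  - by rewrite hE !cS //; split=> //; apply/edgesP; exists x, y.
have sh : h @: (T :\ [set r; Some i]) \subset edges (rooted S).
  by apply/subsetP=> _ /imsetP[e /edgeT[he _] ->].
apply: (@le_trans _ _ (tree_weight w (h @: (T :\ [set r; Some i])))).
  apply: mst_cost_le sh _; apply/connectedP=> x y Sx Sy.
  rewrite -(cS x Sx) -(cS y Sy).
  have /connectP[p pT ->] : connect (adj T) x y.
    by apply: (connectedP _ _ conT); rewrite in_rootedU1 ?Sx ?Sy orbT.
  elim: p x pT {Sx} => //= z p IHp x /andP[xz /IHp]; apply: connect_trans.
  (* The removed edge collapses to the root, so this step of the path becomes trivial; every other
     edge has its image in the contracted set. *)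
  have [xzE|nxz] := eqVneq [set x; z] [set r; Some i]; last first.
    by apply: connect1; rewrite /adj -hE imset_f // in_setD1 nxz.
  have: x \in [set r; Some i] by rewrite -xzE !inE eqxx.
  have: z \in [set r; Some i] by rewrite -xzE !inE eqxx orbT.
  by rewrite /contract !inE => /orP[]/eqP-> /orP[]/eqP->; rewrite ?eqxx ?connect0.
apply: le_trans (ler_sum_imset _) _ => [e /(subsetP sh)/edge_ge0 //|].
by apply: ler_sum => e /edgeT[].
Qed.

(** Attachment and contraction bound each marginal from below and above by zero. *)
Lemma shapley_eq0 : shapley (saving_game w) i = 0.
Proof.
rewrite /shapley big1 ?mulr0 // => p _; apply/eqP; rewrite eq_le.
rewrite saving_marginal_ge0 ?notin_Prc // andbT saving_marginal ?notin_Prc //.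
by rewrite subr_le0 mst_cost_contract ?notin_Prc.
Qed.

End RootNearest.

End Savings.

Theorem theorem3p1 (R : realFieldType) (n : nat) (w : {set node n} -> R)
  (w_ge0 : forall x y : node n, x != y -> 0 <= wt w x y) (i : 'I_n) :
  [<-> shapley (saving_game w) i = 0;
       null_player (saving_game w) i;
       forall j : 'I_n, j != i ->
         saving_game w [set i; j] = saving_game w [set j];
       forall j : 'I_n, j != i ->
         wt w (root_node n) (Some i) <= wt w (Some i) (Some j) /\
         wt w (root_node n) (Some j) <= wt w (Some i) (Some j)].
Proof.
tfae.
- exact: shapley_eq0_null.
- by move=> null j nji; apply: null; rewrite inE eq_sym.
- by move=> pair0 j nji; apply: pair_null_root_le (pair0 j nji).
- exact: shapley_eq0.
Qed.
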